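(* Let $d\ge 2$ and $2\le \ell\le k$ be integers. Let $F$ be an $\ell$-disjoint $(k,d)$-CSP, and call a variable $x$ frequent in $F$ if $\deg(x,F)>\frac{d^k}{e\,d^{\ell-1}k}$. If the number of variables that are frequent in $F$ is at most $\left(\frac{d^k}{e\,d^{\ell-1}k}\right)^{\frac{1}{\ell-1}}$, then $F$ is satisfiable.
   Context: Variables take values in $\{0,1,\dots,d-1\}$. A literal is an expression $x\neq b$ with $x$ a variable and $b\in\{0,\dots,d-1\}$. A $k$-constraint is a set of $k$ literals involving $k$ distinct variables; a $(k,d)$-CSP is a finite set of $k$-constraints. An assignment $\alpha$ satisfies $x\ne b$ if $\alpha(x)\ne b$, satisfies a constraint if it satisfies at least one of its literals, and satisfies a CSP if it satisfies all its constraints. For a constraint $C$, $\mathrm{vbl}(C)$ is the set of variables occurring in $C$ (i.e. $x$ with $x\ne b\in C$ for some $b$); $\deg(x,F)$ is the number of constraints $C\in F$ with $x\in\mathrm{vbl}(C)$. $F$ is $\ell$-disjoint if there are no two distinct constraints $C,D\in F$ with $|\mathrm{vbl}(C)\cap\mathrm{vbl}(D)|\ge\ell$. *)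

(* Defs.v *)
From mathcomp Require Import all_boot all_order all_algebra.
From mathcomp Require Import finmap.
From mathcomp Require Import reals sequences exp.

Set Implicit Arguments.
Unset Strict Implicit.
Unset Printing Implicit Defensive.

Import Order.TTheory GRing.Theory Num.Theory.
Local Open Scope fset_scope.
Local Open Scope ring_scope.

(* The pair (x, b) encodes the literal x <> b. *)
Notation literal V d := (V * 'I_d)%type.

Notation constraint V d := {fset literal V d}.

Section Csp.
Context {V : choiceType} {d : nat}.

Definition satisfies_literal (alpha : V -> 'I_d) (u : literal V d) : bool :=
  alpha u.1 != u.2.

Definition satisfies_constraint (alpha : V -> 'I_d) (C : constraint V d) : Prop :=
  exists2 u, u \in C & satisfies_literal alpha u.

Definition satisfies_csp (alpha : V -> 'I_d) (F : {fset constraint V d}) : Prop :=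
  forall C, C \in F -> satisfies_constraint alpha C.

Definition satisfiable (F : {fset constraint V d}) : Prop :=
  exists alpha : V -> 'I_d, satisfies_csp alpha F.

Definition vbl (C : constraint V d) : {fset V} := [fset u.1 | u in C].

Definition is_constraint (k : nat) (C : constraint V d) : Prop :=
  #|` C| = k /\ #|` vbl C| = k.

Definition is_csp (k : nat) (F : {fset constraint V d}) : Prop :=
  forall C, C \in F -> is_constraint k C.

Definition deg (x : V) (F : {fset constraint V d}) : nat :=
  #|` [fset C in F | x \in vbl C]|.

Definition disjoint_csp (l : nat) (F : {fset constraint V d}) : Prop :=
  ~ exists C D, [/\ C \in F, D \in F, C != D & (l <= #|` vbl C `&` vbl D|)%N].

Definition csp_vars (F : {fset constraint V d}) : {fset V} :=
  \bigcup_(C <- F) vbl C.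

End Csp.

Definition threshold (R : realType) (d k l : nat) : R :=
  d%:R ^+ k / (expR 1 * d%:R ^+ (l - 1) * k%:R).

Definition frequent (R : realType) (V : choiceType) (d k l : nat)
    (F : {fset constraint V d}) (x : V) : bool :=
  threshold R d k l < (deg x F)%:R.

(* The threshold is nonnegative, so a frequent variable has positive degree and
   restricting to the finite set csp_vars F loses no frequent variable. *)
Definition frequent_vars (R : realType) (V : choiceType) (d k l : nat)
    (F : {fset constraint V d}) : {fset V} :=
  [fset x in csp_vars F | frequent R k l F x].

(* Main.v *)
(* Let X be the set of frequent variables and T the threshold.  Delete the
   X-literals of every constraint with fewer than l variables in X, and keep the
   other constraints intact; satisfying the shortened CSP satisfies F, and every
   constraint still has at least k - l + 1 variables.  Each variable now lies in
   at most T constraints: outside X by definition, and for x in X because the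
   surviving constraints through x are determined, by l-disjointness, by l - 1
   further variables of X, so there are at most |X|^(l-1) <= T of them.  Hence a
   constraint meets at most k T constraints (itself included), and the local
   lemma applies because e d^-(k-l+1) k T = 1. *)

Require Import Defs.
From mathcomp Require Import all_boot all_order all_algebra.
From mathcomp Require Import finmap.
From mathcomp Require Import reals sequences exp.
From mathcomp Require Import ring.

Set Implicit Arguments.
Unset Strict Implicit.
Unset Printing Implicit Defensive.

Import Order.TTheory GRing.Theory Num.Theory.
Local Open Scope ring_scope.

(** * Lopsided local lemma in counting form *)

Section LocalLemma.
Variables (R : realFieldType) (O I : finType) (A : I -> {set O}).

Definition avoid (S : {set I}) : {set O} :=
  [set w | [forall i in S, w \notin A i]].

Lemma avoidP (S : {set I}) w :
  reflect (forall i, i \in S -> w \notin A i) (w \in avoid S).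
Proof. by rewrite inE; apply: forall_inP. Qed.

Lemma avoidS (S S' : {set I}) : S \subset S' -> avoid S' \subset avoid S.
Proof.
move=> sSS'; apply/subsetP => w /avoidP Hw; apply/avoidP => i iS.
exact/Hw/(subsetP sSS').
Qed.

Lemma avoid0 : avoid set0 = setT.
Proof. by apply/setP => w; rewrite [RHS]inE; apply/avoidP => i; rewrite inE. Qed.

Lemma card_avoidU1 (S : {set I}) j :
  (#|A j :&: avoid S| + #|avoid (j |: S)|)%N = #|avoid S|.
Proof.
rewrite -(cardsID (A j) (avoid S)) setIC; congr (_ + #|pred_of_set _|)%N.
apply/setP => w; apply/avoidP/setDP => [H|[/avoidP H wj] i].
  split; first by apply/avoidP => i iS; apply: H; rewrite setU1r.
  by apply: H; rewrite setU11.
by rewrite in_setU1 => /predU1P[->|/H].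
Qed.

Variables (x p : R) (adj : I -> {set I}) (D : nat).
Hypothesis x01 : 0 <= x < 1.
Hypothesis adj_card : forall i, (#|adj i :\ i| <= D)%N.
(** Under the uniform measure on [O] this bounds by [p] the probability of [A i] conditioned on
    [avoid S]. With denominators cleared, no case of an empty conditioning event arises. *)
Hypothesis indep : forall i (S : {set I}), [disjoint S & adj i] ->
  #|A i :&: avoid S|%:R <= p * #|avoid S|%:R.
Hypothesis ple : p <= x * (1 - x) ^+ D.

(** Chain rule: the indices of [S :\: S'] are added to [S'] one at a time, each costing a factor
    [1 - x]. Assuming the bound on bad events only for sets smaller than [n] lets this run inside
    the induction that proves that bound. *)
Lemma avoid_extend n (S S' : {set I}) :
  (forall j (Z : {set I}), (#|Z| < n)%N ->
     #|A j :&: avoid Z|%:R <= x * #|avoid Z|%:R) ->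
  S' \subset S -> (#|S| <= n)%N ->
  (1 - x) ^+ #|S :\: S'| * #|avoid S'|%:R <= #|avoid S|%:R.
Proof.
case/andP: x01 => x0 x1 IH; have [m] := ubnP #|S :\: S'|.
elim: m S => // m IHm S; rewrite ltnS => ltm sS'S leSn.
have [SS'0|[j]] := set_0Vmem (S :\: S').
  rewrite SS'0 cards0 mul1r ler_nat subset_leq_card // avoidS //.
  by rewrite -setD_eq0 SS'0.
move=> jSS'; have /setDP[jS jS'] := jSS'.
have cS := cardsD1 j S; rewrite jS in cS.
have cSS' := cardsD1 j (S :\: S'); rewrite jSS' in cSS'.
have eSS' : S :\: S' :\ j = S :\ j :\: S'.
  by apply/setP => i; rewrite !inE andbCA.
have sub : S' \subset S :\ j by rewrite subsetD1 sS'S.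
have IHj : (1 - x) ^+ #|S :\ j :\: S'| * #|avoid S'|%:R <= #|avoid (S :\ j)|%:R.
  apply: IHm => //; last by rewrite (leq_trans _ leSn) // cS leq_addl.
  by move: ltm; rewrite cSS' eSS'.
rewrite cSS' eSS' exprS -mulrA.
apply: le_trans (_ : (1 - x) * #|avoid (S :\ j)|%:R <= _).
  by rewrite ler_wpM2l // subr_ge0 ltW.
have E := card_avoidU1 (S :\ j) j; rewrite setD1K // in E.
rewrite mulrBl mul1r lerBlDr -{1}E natrD addrC lerD2l.
by apply: IH; rewrite (leq_trans _ leSn) // cS.
Qed.

(** Strong induction on the size of [S]. Dropping the neighbours of [i] from [S] only enlarges the
    left side, to which [indep] then applies; [avoid_extend] restores the neighbours at the cost of
    at most [D] factors [1 - x], which [ple] has paid in advance. *)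
Lemma bad_le (S : {set I}) i : #|A i :&: avoid S|%:R <= x * #|avoid S|%:R.
Proof.
case/andP: x01 => x0 x1; have [n] := ubnP #|S|.
elim: n S i => // n IHn S i; rewrite ltnS => leSn.
(* When [i] lies in [S] the left side is zero. Otherwise the dropped indices lie in [adj i :\ i],
   the set that [adj_card] bounds. *)
have [iS|iS] := boolP (i \in S).
  rewrite (_ : _ :&: _ = set0) ?cards0 ?mulr_ge0 //.
  apply/setP => w; rewrite [RHS]inE; apply/negP => /setIP[wi /avoidP/(_ _ iS)].
  by rewrite wi.
pose S' := S :\: adj i.
have S'S : S' \subset S by apply: subsetDl.
apply: le_trans (_ : #|A i :&: avoid S'|%:R <= _).
  by rewrite ler_nat subset_leq_card // setIS // avoidS.
apply: le_trans (indep _) _.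
  rewrite -setI_eq0 -subset0; apply/subsetP => j.
  by rewrite !inE => /andP[/andP[/negPf->]].
apply: le_trans (ler_wpM2r _ ple) _ => //; rewrite -mulrA ler_wpM2l //.
apply: le_trans (avoid_extend (n := n) _ S'S leSn); last by move=> j Z /IHn.
rewrite ler_wpM2r // ler_wiXn2l ?subr_ge0 ?(ltW x1) ?gerBl //.
apply: leq_trans (adj_card i); apply/subset_leq_card/subsetP => j.
rewrite !inE negb_and negbK => /andP[/orP[->|/negPf->] // jS].
by rewrite andbT; apply: contraNneq iS => <-.
Qed.

Lemma lopsided_local_lemma : (0 < #|O|)%N -> exists w, forall i, w \notin A i.
Proof.
case/andP: x01 => x0 x1 O0.
have [T0|[w /avoidP Hw]] := set_0Vmem (avoid setT); last by exists w => i; apply: Hw.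
have := avoid_extend (fun j Z _ => bad_le Z j) (sub0set setT) (leqnn _).
rewrite avoid0 cardsT T0 cards0 leNgt mulr_gt0 ?ltr0n //.
by rewrite exprn_gt0 // subr_gt0.
Qed.

End LocalLemma.

(** Members of [A] share one pattern on [D], and [B] does not look at [D]. Overwriting a member of
    [A :&: B] on [D] by an arbitrary pattern therefore stays in [B], and the pair can be recovered
    from the result. *)
Lemma card_cylinder (W T : finType) (D : {set W}) (A B : {set {ffun W -> T}}) :
  (forall f g : {ffun W -> T}, f \in A -> g \in A -> {in D, f =1 g}) ->
  (forall f g : {ffun W -> T}, {in ~: D, f =1 g} -> f \in B -> g \in B) ->
  (#|A :&: B| * #|T| ^ #|D| <= #|B|)%N.
Proof.
move=> Afix Bout.
have [->|[f0 /setIP[f0A _]]] := set_0Vmem (A :&: B); first by rewrite cards0.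
have [D0|[v0 v0D]] := set_0Vmem D.
  by rewrite D0 cards0 muln1 subset_leq_card // subsetIr.
(* A pattern on [D] is stored as a total function equal to [t0] off [D]; [v0] serves only to exhibit
   this default value. *)
pose t0 := f0 v0.
pose P := [set h : {ffun W -> T} | h \in pffun_on t0 (mem D) (mem T)].
have cP : #|P| = (#|T| ^ #|D|)%N by rewrite cardsE card_pffun_on.
rewrite -cP -cardsX.
pose o (u : {ffun W -> T} * {ffun W -> T}) :=
  [ffun v => if v \in D then u.2 v else u.1 v].
rewrite -(card_in_imset (f := o)).
  apply/subset_leq_card/subsetP => _ /imsetP[[f h] /setXP[/setIP[fA fB] _] ->].
  by apply: Bout fB => v; rewrite inE ffunE /= => /negPf->.
move=> [f h] [f' h'] /setXP[/setIP[/= fA _] hP] /setXP[/setIP[/= f'A _] h'P].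
move=> /ffunP /= E; congr pair; apply/ffunP => v; have := E v; rewrite !ffunE /=.
  by case: ifP => // vD _; apply: Afix.
case: ifP => // vD _; move: hP h'P; rewrite !inE.
by move=> /pffun_onP[/supportP h1 _] /pffun_onP[/supportP h2 _];
  rewrite h1 ?h2 ?vD.
Qed.

(* The weight 1/(D+2), rather than the usual 1/(D+1), stays below 1 when D = 0. *)
Lemma local_lemma_weight (R : realType) (p : R) (D : nat) :
  expR 1 * p * D.+1%:R <= 1 ->
  p <= D.+2%:R^-1 * (1 - D.+2%:R^-1) ^+ D.
Proof.
move=> ep.
have e0 : 0 < expR 1 :> R := expR_gt0 1.
have D1 : 0 < D.+1%:R :> R by rewrite ltr0n.
have D2 : 0 < D.+2%:R :> R by rewrite ltr0n.
have -> : 1 - D.+2%:R^-1 = D.+1%:R / D.+2%:R :> R.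
  rewrite -[X in X - _](divff (lt0r_neq0 D2)) -[X in _ - X]mul1r -mulrBl.
  by rewrite [D.+2%:R]mulrSr addrK.
(* This is (1 + 1/(D+1))^(D+1) <= e, obtained from 1 + t <= exp t. *)
have He : D.+2%:R ^+ D.+1 <= expR 1 * D.+1%:R ^+ D.+1 :> R.
  rewrite -ler_pdivrMr ?exprn_gt0 // -expr_div_n.
  have -> : expR 1 = expR (D.+1%:R^-1) ^+ D.+1 :> R.
    by rewrite -expRM_natl divff // lt0r_neq0.
  rewrite lerXn2r ?nnegrE ?expR_ge0 ?divr_ge0 ?(ltW D1) ?(ltW D2) //.
  apply: le_trans (expR_ge1Dx _).
  by rewrite [D.+2%:R]mulrSr mulrDl divff ?lt0r_neq0 // mul1r.
rewrite expr_div_n mulrCA -invfM -exprS ler_pdivlMr ?exprn_gt0 //.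
rewrite -(ler_pM2r D1) -exprSr.
have [p0|p0] := leP 0 p; last first.
  apply: le_trans (_ : 0 <= _); last by rewrite exprn_ge0 // ltW.
  by rewrite pmulr_lle0 // pmulr_lle0 ?exprn_gt0 // ltW.
apply: le_trans (_ : p * (expR 1 * D.+1%:R ^+ D.+1) * D.+1%:R <= _).
  by rewrite ler_pM2r // ler_wpM2l.
rewrite mulrAC mulrA -[leRHS]mul1r ler_wpM2r ?exprn_ge0 ?(ltW D1) //.
by rewrite mulrAC (mulrC p).
Qed.

(** * Local lemma for families of constraints, and a count of stars *)

Local Open Scope fset_scope.

Lemma card_bigcup_le (I T : finType) (F : I -> {set T}) :
  (#|(\bigcup_i F i)%SET| <= \sum_i #|F i|)%N.
Proof.
elim/big_rec2: _ => [|i n S _ Sn]; first by rewrite cards0.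
by apply: leq_trans (leq_card_setU _ _) _; rewrite leq_add2l.
Qed.

Lemma card_fset_in (V : choiceType) (U W : {fset V}) :
  U `<=` W -> (#|` U| <= #|[set v : W | val v \in U]|)%N.
Proof.
move=> UW; have fI : injective (fincl UW).
  by move=> u v /(congr1 val) /= uv; apply: val_inj.
rewrite cardfE -cardsT -(card_imset _ fI).
by apply/subset_leq_card/subsetP => _ /imsetP[u _ ->]; rewrite inE /= fsvalP.
Qed.

Lemma mem_vbl (V : choiceType) (d : nat) (C : constraint V d) u :
  u \in C -> u.1 \in vbl C.
Proof. by move=> uC; rewrite in_imfset. Qed.

(** A uniform assignment violates a constraint on at least [m] variables with probability at most
    d^-m, and constraints are adjacent when they share a variable. Each neighbourhood contains its
    own index, so its size plays the role of D + 1 in the symmetric condition e p (D+1) <= 1. *)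
Lemma csp_local_lemma (R : realType) (V : choiceType) (d m : nat)
    (I : finType) (g : I -> constraint V d) :
  (0 < d)%N -> (0 < m)%N ->
  (forall i, m <= #|` vbl (g i)|)%N ->
  (forall i, expR 1 * #|[set j | vbl (g i) `&` vbl (g j) != fset0]|%:R
               <= d%:R ^+ m :> R) ->
  exists alpha : V -> 'I_d, forall i, satisfies_constraint alpha (g i).
Proof.
move=> d0 m0 gm ge; pose o := Ordinal d0.
have [i0 _|I0] := pickP I; last by exists (fun=> o) => i; have := I0 i.
(* Only the variables that occur are sampled, which makes the sample space finite; [ext] gives every
   other variable the value [o]. *)
pose W := \bigcup_(i <- enum I) vbl (g i).
have gW i : vbl (g i) `<=` W by apply: bigfcup_sup; rewrite ?mem_enum.
pose ext (w : {ffun W -> 'I_d}) x := oapp w o (insub x).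
pose A i := [set w | [forall u : g i, ext w (val u).1 == (val u).2]].
pose adj i := [set j | vbl (g i) `&` vbl (g j) != fset0].
have adjii i : i \in adj i.
  by rewrite inE fsetIid -cardfs_gt0 (leq_trans m0).
have [D gD eD] : exists2 D, forall i, (#|adj i| <= D.+1)%N &
    expR 1 * D.+1%:R <= d%:R ^+ m :> R.
  case: (@arg_maxnP I i0 predT (fun i => #|adj i|)) => // i1 _ i1max.
  have a1 : (0 < #|adj i1|)%N by apply/card_gt0P; exists i1.
  by exists #|adj i1|.-1 => [i|]; rewrite prednK //; [exact: i1max | exact: ge].
pose p : R := (d%:R ^+ m)^-1.
have dm0 : 0 < d%:R ^+ m :> R by rewrite exprn_gt0 // ltr0n.
have [|||||w Hw] := @lopsided_local_lemma R _ I A (D.+2%:R^-1) p adj D.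
- by rewrite invr_ge0 ler0n invf_lt1 ?ltr1n ?ltr0n.
- move=> i; rewrite -ltnS (leq_trans _ (gD i)) // [X in (_ <= X)%N](cardsD1 i).
  by rewrite adjii.
- move=> i S Si; rewrite ler_pdivlMl // -natrX -natrM ler_nat.
  pose Dv := [set v : W | val v \in vbl (g i)].
  apply: leq_trans (_ : #|A i :&: avoid A S| * #|'I_d| ^ #|Dv| <= _)%N.
    rewrite mulnC leq_mul2l card_ord leq_pexp2l ?orbT //.
    exact: leq_trans (gm i) (card_fset_in (gW i)).
  (* A violating assignment takes the forbidden value on every variable of [g i], while constraints
     not adjacent to [g i] do not see these variables. *)
  apply: card_cylinder => [w w'|w w' ww' /avoidP H].
    rewrite !inE => /forallP Hw /forallP Hw' v; rewrite inE => /imfsetP[u /= ui vu].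
    have := Hw [` ui]; have := Hw' [` ui]; rewrite /ext /= -vu valK /=.
    by move=> /eqP-> /eqP->.
  apply/avoidP => j jS; apply: contra (H j jS); rewrite !inE.
  move=> /forallP Hw'; apply/forallP => u; rewrite -(eqP (Hw' u)); apply/eqP.
  have uW : (val u).1 \in W by apply: (fsubsetP (gW j)); apply/mem_vbl/fsvalP.
  rewrite /ext insubT /= ww' // !inE /=; apply/negP => ui.
  have := disjointFr Si jS; rewrite inE => /negbFE/eqP/fsetP/(_ (val u).1).
  by rewrite !inE ui mem_vbl ?fsvalP.
- apply: local_lemma_weight; rewrite mulrAC ler_pdivrMr // mul1r //.
- by apply/card_gt0P; exists [ffun=> o].
exists (ext w) => i; have := Hw i; rewrite inE negb_forall => /existsP[u Hu].
by exists (val u) => //; apply: fsvalP.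
Qed.

(** Each [j] in [P] is encoded by the first [n] elements of [U j] in [X] other than [x]. Equal codes
    give [n] common elements, and [x] is one more, so the indices coincide. *)
Lemma card_star_le (V : choiceType) (J : finType) (U : J -> {fset V})
    (X : {fset V}) (x : V) (n : nat) (P : {set J}) :
  x \in X ->
  (forall j, j \in P -> x \in U j /\ (n < #|` U j `&` X|)%N) ->
  (forall i j, i \in P -> j \in P -> (n < #|` U i `&` U j|)%N -> i = j) ->
  (#|P| <= #|` X| ^ n)%N.
Proof.
move=> xX PU Pinj.
pose Y j := enum_fset ((U j `&` X) `\ x).
(* For [j] in [P] neither default is reached: [Y j] has at least [n] entries, all in [X]. *)
pose t j := [tuple insubd [` xX] (nth x (Y j) i) | i < n].
have szY j : j \in P -> (n <= size (Y j))%N.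
  case/PU=> xj; rewrite -ltnS (cardfsD1 x (U j `&` X)) in_fsetI xj xX.
  by rewrite add1n.
rewrite [#|` X|]cardfE -card_tuple -(card_in_imset (f := t)) ?max_card //.
move=> i j iP jP tij; apply: Pinj => //.
have Yij : take n (Y i) = take n (Y j).
  have sz h : h \in P -> size (take n (Y h)) = n by move=> hP; rewrite size_takel ?szY.
  apply: (@eq_from_nth _ x) => [|a]; rewrite !sz // => an.
  have := congr1 (fun u => val (tnth u (Ordinal an))) tij.
  rewrite !tnth_mktuple /= !nth_take // !val_insubd.
  have YX h : h \in P -> nth x (Y h) a \in X.
    move=> hP; have : nth x (Y h) a \in Y h by rewrite mem_nth // (leq_trans an) ?szY.
    by rewrite !inE => /and3P[].
  by rewrite !YX.
have -> : n.+1 = size (x :: take n (Y i)) by rewrite /= size_takel ?szY.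
apply: uniq_leq_size.
  rewrite /= take_uniq ?fset_uniq // andbT.
  by apply/negP => /mem_take; rewrite !inE eqxx.
move=> y; rewrite in_cons => /predU1P[->|yi].
  by rewrite in_fsetI; have [-> _] := PU _ iP; have [-> _] := PU _ jP.
have := yi; rewrite Yij => /mem_take; move/mem_take: yi.
by rewrite !inE => /and3P[_ -> _] /and3P[_ -> _].
Qed.

(** * Shortening the constraints and bounding their degrees *)

Lemma vbl_filter (V : choiceType) (d : nat) (C : constraint V d) (X : {fset V}) :
  vbl [fset u in C | u.1 \notin X] = vbl C `\` X.
Proof.
apply/fsetP => x; rewrite !inE; apply/imfsetP/andP => [[u]|[xX /imfsetP[u /= uC xu]]].
  by rewrite !inE /= => /andP[uC uX] ->; rewrite uX mem_vbl.
by exists u; rewrite // !inE uC -xu.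
Qed.

Lemma card_deg (V : choiceType) (d : nat) (F : {fset constraint V d}) x :
  #|[set C : F | x \in vbl (val C)]| = deg x F.
Proof.
apply/eqP; rewrite eqn_leq; apply/andP; split.
  rewrite cardE -(size_map val); apply: uniq_leq_size.
    by rewrite map_inj_uniq ?enum_uniq //; apply: val_inj.
  by move=> _ /mapP[C + ->]; rewrite mem_enum !inE fsvalP.
rewrite cardE -(size_map val); apply: uniq_leq_size; first exact: fset_uniq.
move=> C; rewrite !inE /= => /andP[CF xC]; apply/mapP; exists [` CF] => //.
by rewrite mem_enum inE.
Qed.

Lemma threshold_ge0 (R : realType) (d k l : nat) : 0 <= threshold R d k l.
Proof. by rewrite divr_ge0 ?exprn_ge0 ?mulr_ge0 ?expR_ge0 ?exprn_ge0. Qed.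

Theorem theorem2 (R : realType) (V : choiceType) (d k l : nat)
    (F : {fset constraint V d})
    (hd : (2 <= d)%N) (hl : (2 <= l)%N) (hlk : (l <= k)%N)
    (hF : is_csp k F) (hdisj : disjoint_csp l F)
    (hfreq : #|` frequent_vars R k l F|%:R
               <= powR (threshold R d k l) (1 / (l - 1)%:R)) :
  satisfiable F.
Proof.
set X := frequent_vars R k l F in hfreq.
set T := threshold R d k l in hfreq.
have T0 : 0 <= T := threshold_ge0 R d k l.
have l1 : (0 < l - 1)%N by rewrite subn_gt0.
have hX : (#|` X| ^ (l - 1))%:R <= T.
  rewrite natrX; apply: le_trans (_ : (T `^ (1 / (l - 1)%:R)) ^+ (l - 1) <= _).
    by rewrite lerXn2r ?nnegrE ?powR_ge0.
  by rewrite -powR_mulrn ?powR_ge0 // -powRrM divfK ?powRr1 // pnatr_eq0 -lt0n.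
(* The family stays indexed by [F], so constraints that become equal after shortening are still
   counted separately. *)
pose g (C : F) : constraint V d :=
  if (l <= #|` vbl (val C) `&` X|)%N then val C
  else [fset u in val C | u.1 \notin X].
have gsub C : vbl (g C) `<=` vbl (val C).
  by rewrite /g; case: ifP => // _; rewrite vbl_filter fsubsetDl.
have degg C x : x \in vbl (g C) -> #|[set C' | x \in vbl (g C')]|%:R <= T.
  move=> xC; have [xX|xX] := boolP (x \in X).
    apply: le_trans hX; rewrite ler_nat; rewrite subn1.
    apply: (card_star_le (U := fun C' : F => vbl (val C')) xX) => [C'|C1 C2 _ _].
      rewrite inE => xC'; split; first exact: (fsubsetP (gsub C')).
      move: xC'; rewrite prednK ?(leq_trans _ hl) // /g; case: (leqP l) => // _.
      by rewrite vbl_filter inE xX.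
    rewrite prednK ?(leq_trans _ hl) // => lC; apply/eqP/negPn/negP => C12.
    by apply: hdisj; exists (val C1), (val C2); rewrite !fsvalP.
  apply: le_trans (_ : (deg x F)%:R <= _).
    rewrite ler_nat -card_deg; apply/subset_leq_card/subsetP => C'.
    by rewrite !inE; apply/fsubsetP.
  (* [X] was cut out of [csp_vars F], so lying outside [X] means being infrequent only once [x] is
     known to occur in [F]. *)
  have : x \in csp_vars F.
    apply/bigfcupP; exists (val C); first by rewrite fsvalP.
    exact: (fsubsetP (gsub C)).
  by move=> xF; move: xX; rewrite !inE /= xF /= -leNgt.
(* A shortened constraint had at most [l - 1] of its [k] variables in [X]. *)
have [||||alpha Halpha] := @csp_local_lemma R V d (k - (l - 1)) F g.
- exact: ltnW.
- by rewrite subn_gt0; apply: leq_trans hlk; rewrite ltn_subrL (leq_trans _ hl).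
- move=> C; have Ck : #|` vbl (val C)| = k by case: (hF _ (fsvalP C)).
  rewrite /g; case: (leqP l) => lC; first by rewrite Ck leq_subr.
  rewrite vbl_filter cardfsD Ck leq_sub2l //.
  by rewrite -ltnS subn1 prednK // (leq_trans _ hl).
- move=> C.
  have -> : d%:R ^+ (k - (l - 1)) = expR 1 * (k%:R * T).
    have e0 : expR 1 != 0 :> R := lt0r_neq0 (expR_gt0 1).
    have d0 : d%:R != 0 :> R by rewrite pnatr_eq0 -lt0n ltnW.
    have k0 : k%:R != 0 :> R by rewrite pnatr_eq0 -lt0n (leq_trans _ hlk) // ltnW.
    rewrite /T /threshold expfB_cond ?(negPf d0) ?add0n; last first.
      by rewrite (leq_trans _ hlk) // leq_subr.
    by field; rewrite e0 k0 expf_neq0.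
  rewrite ler_pM2l ?expR_gt0 //.
  (* Every neighbour shares some variable [x] with [g C] and so lies in [N x]; there are at most [k]
     such sets, each of size at most [T] by [degg]. *)
  pose N (x : vbl (g C)) := [set C' | val x \in vbl (g C')].
  apply: le_trans (_ : (\sum_x #|N x|)%:R <= _).
    rewrite ler_nat; apply: leq_trans (card_bigcup_le _).
    apply/subset_leq_card/subsetP => C'; rewrite inE => /fset0Pn[x].
    rewrite inE => /andP[xC xC']; apply/finset.bigcupP; exists [` xC] => //.
    by rewrite inE.
  apply: le_trans (_ : #|` vbl (g C)|%:R * T <= _).
    rewrite natr_sum cardfE mulr_natl -sumr_const.
    by apply: ler_sum => x _; apply/degg/fsvalP.
  rewrite ler_wpM2r // ler_nat; have [_ <-] := hF _ (fsvalP C).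
  exact: fsubset_leq_card.
exists alpha => C CF; have [u] := Halpha [` CF].
rewrite /g /=; case: ifP => _ ui Hu; exists u => //.
by move: ui; rewrite !inE => /andP[].
Qed.
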